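(* Let $\mathcal{O}$ be an order ideal in $\mathbb{T}^n$. Then the following conditions are equivalent. (a) The order ideal $\mathcal{O}$ is simplicial. (b) The total arrow degree is a positive grading on $K[C]$.
   Context: $K$ is a field, $P=K[x_1,\dots,x_n]$, and $\mathbb{T}^n$ is the set of terms (power products) in $x_1,\dots,x_n$. An order ideal is a finite set $\mathcal{O}=\{t_1,\dots,t_\mu\}\subseteq\mathbb{T}^n$ closed under taking divisors; its border is $\partial\mathcal{O}=(x_1\mathcal{O}\cup\dots\cup x_n\mathcal{O})\setminus\mathcal{O}=\{b_1,\dots,b_\nu\}$. Let $\mathcal{O}_i$ be the set of terms of degree $i$ in $\mathcal{O}$, and $\mathrm{HF}_P(i)=\dim_K P_i$. For $d\ge1$, the order ideal $\mathcal{O}$ is simplicial of type $d$ if $\#\mathcal{O}_i=\mathrm{HF}_P(i)$ for $i\le d$ and $\#\mathcal{O}_i=0$ for $i>d$; it is simplicial if it is simplicial of some type $d$. For indeterminates $c_{ij}$ ($1\le i\le\mu$, $1\le j\le\nu$), $C=(c_{ij})$ and $K[C]=K[c_{11},\dots,c_{\mu\nu}]$, the total arrow degree is given by the $\mathbb{Z}$-grading on $K[C]$ with $\deg_W(c_{ij})=\deg(b_j)-\deg(t_i)$; it is a positive grading if every $c_{ij}$ has positive degree.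
   Formalization: The order ideal is assumed nonempty, and O = {1} is excluded unless n = 0: in these cases (b) holds but (a) fails, because a simplicial type must be d ≥ 1 (for O = {1}, n ≥ 1 all c_ij have degree 1 but #O_1 = 0 ≠ n). *)

(* Defs.v *)
From HB Require Import structures.
From mathcomp Require Import all_boot all_order all_algebra.
From mathcomp Require Import finmap.
From mathcomp Require Import mpoly.

Set Implicit Arguments.
Unset Strict Implicit.
Unset Printing Implicit Defensive.

Import GRing.Theory Num.Theory.

Local Open Scope fset_scope.
Local Open Scope ring_scope.

(* The library makes [dhomog n K i], the space of forms of degree i in        *)
(* K[x_1, ..., x_n], a vectType only when n is a successor; the alias         *)
(* [homcomp] carries that structure for every n, including n = 0.             *)
Definition homcomp (n : nat) (K : fieldType) (i : nat) : Type := dhomog n K i.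

HB.instance Definition _ (n : nat) (K : fieldType) (i : nat) :=
  GRing.Lmodule.copy (homcomp n K i) (dhomog n K i).

Lemma homcomp_vecaxiom (n : nat) (K : fieldType) (i : nat) :
  Vector.axiom 'C((i + n).-1, i) (homcomp n K i).
Proof.
case: n => [|n]; last by rewrite addnS; exact: dhomog_vecaxiom.
have m0 (m : 'X_{1..0}) : m = 0%MM by apply/mnmP => -[].
have p0 (p : {mpoly K[0]}) : p = (p@_0%MM)%:MP.
  by apply/mpolyP => m; rewrite (m0 m) mcoeffC eqxx mulr1.
exists (fun p : dhomog 0 K i => \row_j (mpoly_of_dhomog p)@_0%MM).
  by move=> a p q; apply/rowP => j; rewrite !mxE /= mcoeffD mcoeffZ.
case: i => [|i].
  exists (fun v : 'rV_('C((0 + 0).-1, 0)) => indhomog 0 (v 0 0)%:MP) => [p|v].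
    by rewrite mxE -p0; apply/val_inj; rewrite /= insubdK //; case: (p).
  apply/rowP => j; rewrite mxE ord1 [mpoly_of_dhomog _]insubdK.
    by rewrite mcoeffC eqxx mulr1.
  exact: nvar0_homog.
have z : 'C((i.+1 + 0).-1, i.+1) = 0%N by rewrite addn0 bin_small.
exists (fun=> indhomog i.+1 0) => [p|v].
  apply/val_inj; rewrite /= insubdK ?rpred0 // [RHS]p0.
  have h : (mpoly_of_dhomog p)@_0%MM = 0.
    by apply: (@dhomog_nemf_coeff _ _ mdeg i.+1); [case: (p) | rewrite /= mdeg0].
  by rewrite h mpolyC0.
by apply/rowP => j; have := ltn_ord j; rewrite {2}z.
Qed.

HB.instance Definition _ (n : nat) (K : fieldType) (i : nat) :=
  Lmodule_hasFinDim.Build K (homcomp n K i) (homcomp_vecaxiom n K i).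

Definition HF (K : fieldType) (n i : nat) : nat := \dim {: homcomp n K i}.

(* Terms are exponent vectors: the product of terms is [+], the term 1 is     *)
(* [0%MM], and divisibility is the pointwise order [(_ <= _)%MM].             *)
Definition order_ideal (n : nat) (O : {fset 'X_{1..n}}) : Prop :=
  forall t u : 'X_{1..n}, t \in O -> (u <= t)%MM -> u \in O.

Definition border (n : nat) (O : {fset 'X_{1..n}}) : {fset 'X_{1..n}} :=
  ((\bigcup_(i <- enum 'I_n) [fset (U_(i) + t)%MM | t in O]) `\` O)%fset.

Definition deg_part (n : nat) (O : {fset 'X_{1..n}}) (i : nat) :
    {fset 'X_{1..n}} :=
  [fset t in O | mdeg t == i].

Definition simplicial_of_type (K : fieldType) (n : nat)
    (O : {fset 'X_{1..n}}) (d : nat) : Prop :=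
  (forall i : nat, (i <= d)%N -> #|` deg_part O i| = HF K n i) /\
  (forall i : nat, (d < i)%N -> #|` deg_part O i| = 0%N).

Definition simplicial (K : fieldType) (n : nat) (O : {fset 'X_{1..n}}) : Prop :=
  exists2 d : nat, (1 <= d)%N & simplicial_of_type K O d.

Definition term (n : nat) (A : {fset 'X_{1..n}}) (i : 'I_#|` A|) : 'X_{1..n} :=
  tnth (in_tuple (enum_fset A)) i.

(* K[C]: the indeterminate c_ij is the one of index [mxvec_index i j].        *)
Definition KC (K : fieldType) (n : nat) (O : {fset 'X_{1..n}}) :=
  {mpoly K[#|` O| * #|` border O|]}.

Definition Cmx (K : fieldType) (n : nat) (O : {fset 'X_{1..n}}) :
    'M[KC K O]_(#|` O|, #|` border O|) :=
  \matrix_(i, j) 'X_(mxvec_index i j).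

Definition arrow_weight (n : nat) (O : {fset 'X_{1..n}}) :
    'M[int]_(#|` O|, #|` border O|) :=
  \matrix_(i, j) ((mdeg (@term n (border O) j))%:Z - (mdeg (@term n O i))%:Z).

Definition arrow_mdeg (n : nat) (O : {fset 'X_{1..n}})
    (m : 'X_{1..#|` O| * #|` border O|}) : int :=
  \sum_(i < #|` O|) \sum_(j < #|` border O|)
     arrow_weight O i j *+ m (mxvec_index i j).

(* The library's weighted homogeneity only has weights in nat, whereas the    *)
(* total arrow degree of an indeterminate may be negative.                    *)
Definition arrow_homog (K : fieldType) (n : nat) (O : {fset 'X_{1..n}})
    (e : int) (f : KC K O) : Prop :=
  forall m : 'X_{1..#|` O| * #|` border O|}, m \in msupp f -> arrow_mdeg m = e.

Definition arrow_degree_positive (K : fieldType) (n : nat)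
    (O : {fset 'X_{1..n}}) : Prop :=
  forall (i : 'I_#|` O|) (j : 'I_#|` border O|),
    exists2 e : int, 0 < e & arrow_homog e (Cmx K O i j).

(* Main.v *)
Require Import Defs.
From mathcomp Require Import all_boot all_order all_algebra.
From mathcomp Require Import finmap.
From mathcomp Require Import mpoly.

Import GRing.Theory Num.Theory.

(** Both conditions say that the order ideal consists of all the terms up to
    some degree d.

    A simplicial order ideal of type d is exactly the set of terms of degree at
    most d, because HF_P(i) counts the terms of degree i ([HF_card_terms]), so
    that the counts prescribed for O_i leave only one choice for O_i: everything
    or nothing ([simplicial_of_typeP]).  On the other side, the total arrow
    degree is positive if and only if every border term has larger degree than
    every term of the order ideal ([arrow_degree_positiveP]).

    If O is the set of terms of degree at most d, then a border term, lying
    outside O, has degree greater than d.  Conversely, let d be the largest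
    degree of a term of O.  Positivity puts the whole border in degrees greater
    than d, and then no term of degree at most d can be missing from O: climbing
    from 1 to that term by one indeterminate at a time, the first step out of O
    would land in the border, in a degree at most d ([mem_low_degree]).

    A type is at least 1, hence O = {1} needs separate treatment; there n = 0,
    and {1} contains every term, so it is simplicial of any type. *)

(** A term of degree d is encoded by the weakly increasing sequence of the
    indices of its d factors; such sequences are known to be counted by a
    binomial coefficient. *)
Definition terms_of_degree (n d : nat) : {fset 'X_{1..n}} :=
  [fset m in [seq s2m t | t : d.-tuple 'I_n <- enum (basis n d)]]%fset.

Lemma mem_terms_of_degree (n d : nat) (m : 'X_{1..n}) :
  (m \in terms_of_degree n d) = (mdeg m == d).
Proof. by rewrite inE /= basis_cover. Qed.

(** Truncated predecessor makes the formula hold without indeterminates: there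
    it gives 'C(0, 0) = 1 in degree 0 and 'C(d - 1, d) = 0 in degree d > 0. *)
Lemma card_terms_of_degree (n d : nat) :
  #|` terms_of_degree n d| = 'C((d + n).-1, d).
Proof.
case: n => [|n].
  have m0 (m : 'X_{1..0}) : m = 0%MM by apply/mnmP => -[].
  have mem0 m : (m \in terms_of_degree 0 d) = (0%N == d).
    by rewrite mem_terms_of_degree (m0 m) mdeg0.
  case: d mem0 => [|d] mem0.
    suff -> : terms_of_degree 0 0 = [fset 0%MM]%fset by rewrite cardfs1.
    by apply/fsetP => m; rewrite mem0 in_fset1 (m0 m) !eqxx.
  rewrite addn0 bin_small ?ltnSn //.
  by apply/eqP; rewrite cardfs_eq0; apply/eqP/fsetP => m; rewrite mem0 inE.
by rewrite /terms_of_degree card_fseq undup_id ?uniq_basis // size_basis addnS.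
Qed.

Lemma HF_card_terms (K : fieldType) (n d : nat) :
  #|` terms_of_degree n d| = HF K n d.
Proof. by rewrite card_terms_of_degree /HF dimvf. Qed.

(** [deg_part O d] is a subset of a set with HF K n d elements, so it has that
    many elements only if it is the whole set. *)
Lemma deg_part_full (K : fieldType) (n : nat) (O : {fset 'X_{1..n}}) (d : nat) :
  #|` deg_part O d| = HF K n d <-> (forall t, mdeg t = d -> t \in O).
Proof.
rewrite -HF_card_terms.
have sub : (deg_part O d `<=` terms_of_degree n d)%fset.
  by apply/fsubsetP => t; rewrite !inE /= -basis_cover => /andP[].
have [_ /esym cardE] := fsubset_leqif_cards sub.
split=> [/eqP|full].
  rewrite -cardE => /eqP/fsetP eqt t dt.
  by have := eqt t; rewrite mem_terms_of_degree dt eqxx !inE => /andP[].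
apply/eqP; rewrite -cardE; apply/eqP/fsetP => t.
by rewrite mem_terms_of_degree !inE /=; case: eqP => [/full ->|]; rewrite ?andbF.
Qed.

Lemma deg_part_empty (n : nat) (O : {fset 'X_{1..n}}) (d : nat) :
  #|` deg_part O d| = 0%N <-> (forall t, t \in O -> mdeg t <> d).
Proof.
split=> [/eqP|empty].
  rewrite cardfs_eq0 => /eqP/fsetP eqt t tO dt.
  by have := eqt t; rewrite !inE /= tO dt eqxx.
apply/eqP; rewrite cardfs_eq0; apply/eqP/fsetP => t; rewrite !inE /=.
by apply/negP => /andP[/empty + /eqP].
Qed.

Lemma simplicial_of_typeP (K : fieldType) (n : nat) (O : {fset 'X_{1..n}})
    (d : nat) :
  simplicial_of_type K O d <-> (forall t, (t \in O) = (mdeg t <= d)%N).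
Proof.
split=> [[full empty] t|memO].
  case: leqP => dt; first exact: (deg_part_full K n O _).1 (full _ dt) t erefl.
  by apply/negP => tO; apply: (deg_part_empty n O _).1 (empty _ dt) t tO erefl.
split=> i di; first by apply/deg_part_full => t dt; rewrite memO dt.
apply/deg_part_empty => t; rewrite memO => + dt.
by rewrite dt leqNgt di.
Qed.

Lemma mem_borderP (n : nat) (O : {fset 'X_{1..n}}) (b : 'X_{1..n}) :
  reflect (b \notin O /\ exists i, exists2 t, t \in O & b = (U_(i) + t)%MM)
          (b \in border O).
Proof.
rewrite in_fsetD; apply: (iffP andP) => -[bO].
  case/bigfcupP=> i _ /imfsetP[t tO bE].
  by split=> //; exists i, t.
case=> i [t tO bE]; split=> //; apply/bigfcupP; exists i.
  by rewrite mem_enum.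
by apply/imfsetP; exists t.
Qed.

Lemma mem_termP (n : nat) (A : {fset 'X_{1..n}}) (t : 'X_{1..n}) :
  reflect (exists i, t = @term n A i) (t \in A).
Proof. exact: (tnthP (in_tuple (enum_fset A)) t). Qed.

Lemma mxvec_index_inj (p q : nat) (i i' : 'I_p) (j j' : 'I_q) :
  mxvec_index i j = mxvec_index i' j' -> i = i' /\ j = j'.
Proof. by move=> /cast_ord_inj/enum_rank_inj[]. Qed.

Lemma arrow_mdeg1 (n : nat) (O : {fset 'X_{1..n}})
    (i : 'I_#|` O|) (j : 'I_#|` border O|) :
  @arrow_mdeg n O U_(mxvec_index i j) = arrow_weight O i j.
Proof.
rewrite /arrow_mdeg (bigD1 i) //= (bigD1 j) //= mnm1E eqxx mulr1n.
rewrite big1 => [|j' /eqP jj']; last first.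
  by rewrite mnm1E; case: eqP => // /mxvec_index_inj[_ /esym].
rewrite big1 ?addr0 // => i' /eqP ii'; rewrite big1 // => j' _.
by rewrite mnm1E; case: eqP => // /mxvec_index_inj[/esym].
Qed.

(** An indeterminate is a single monomial, homogeneous only for its own weight
    deg(b_j) - deg(t_i). *)
Lemma arrow_degree_positiveP (K : fieldType) (n : nat) (O : {fset 'X_{1..n}}) :
  arrow_degree_positive K O <->
  (forall t b, t \in O -> b \in border O -> (mdeg t < mdeg b)%N).
Proof.
have homC i j e : arrow_homog e (Cmx K O i j) <-> arrow_weight O i j = e.
  rewrite -arrow_mdeg1 /arrow_homog mxE msuppX.
  by split=> [->|<- m]; rewrite ?mem_seq1 // => /eqP->.
have wt_gt0 i j :
    (0 < arrow_weight O i j)%R =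
    (mdeg (@term n O i) < mdeg (@term n (border O) j))%N.
  by rewrite mxE subr_gt0 ltz_nat.
split=> [pos _ _ /mem_termP[i ->] /mem_termP[j ->]|lt_tb i j].
  by rewrite -wt_gt0; have [e e0 /homC->] := pos i j.
exists (arrow_weight O i j); last exact/homC.
by rewrite wt_gt0 lt_tb //; apply/mem_termP; [exists i|exists j].
Qed.

Lemma order_ideal0 (n : nat) (O : {fset 'X_{1..n}}) :
  order_ideal O -> O <> fset0 -> 0%MM \in O.
Proof.
move=> hO /eqP/fset0Pn[t tO].
by apply: (hO t) => //; apply/mnm_lepP => i; rewrite mnm0E.
Qed.

(** Induction on the degree: t = x_i u with u of smaller degree, hence u in O by
    induction, so t lies in O or in the border; the degree rules out the
    latter. *)
Lemma mem_low_degree (n : nat) (O : {fset 'X_{1..n}}) (d : nat) :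
    0%MM \in O -> (forall b, b \in border O -> (d < mdeg b)%N) ->
  forall t, (mdeg t <= d)%N -> t \in O.
Proof.
move=> O0 gt_d t; move dt: (mdeg t) => e.
elim: e t dt => [|e IHe] t dt le_d.
  by move/eqP: dt; rewrite mdeg_eq0 => /eqP->.
have [i ti] : exists i, t i != 0%N.
  apply/existsP; apply: contra_eqT dt => /existsPn t0.
  suff -> : t = 0%MM by rewrite mdeg0.
  by apply/mnmP => i; rewrite mnm0E; apply/eqP; rewrite -[_ == _]negbK t0.
have tE : t = (U_(i) + (t - U_(i)))%MM by rewrite addmC submK // lep1mP.
have uO : (t - U_(i))%MM \in O.
  apply: IHe (ltnW le_d).
  by move: dt; rewrite {1}tE mdegD mdeg1 add1n => -[].
have [//|tNO] := boolP (t \in O).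
have /gt_d : t \in border O.
  by apply/mem_borderP; split=> //; exists i, (t - U_(i))%MM.
by rewrite dt ltnNge le_d.
Qed.

Theorem corollary5p2 (K : fieldType) (n : nat) (O : {fset 'X_{1..n}})
    (hO : order_ideal O)
    (hO0 : O <> fset0)
    (hO1 : O = [fset 0%MM]%fset -> n = 0%N) :
  simplicial K O <-> arrow_degree_positive K O.
Proof.
split=> [[d _ /simplicial_of_typeP memO]|/arrow_degree_positiveP lt_tb].
  apply/arrow_degree_positiveP => t b tO /mem_borderP[bNO _].
  by move: tO bNO; rewrite !memO -ltnNge; apply: leq_ltn_trans.
have O0 := order_ideal0 n O hO hO0.
have [s sO le_s] :
    exists2 s, s \in O & forall t, t \in O -> (mdeg t <= mdeg s)%N.
  have [s _ max_s] :=
    @arg_maxnP O [` O0]%fset xpredT (fun x => mdeg (val x)) isT.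
  by exists (val s) => [|t tO]; [exact: valP | exact: (max_s [` tO]%fset)].
pose d := mdeg s.
have memO t : (t \in O) = (mdeg t <= d)%N.
  apply/idP/idP => [/le_s //|]; apply: mem_low_degree => // b bb.
  exact: lt_tb.
(* A largest degree d = 0 is not a valid type. *)
have [d0|d_gt0] := posnP d; last by exists d => //; apply/simplicial_of_typeP.
have OE : O = [fset 0%MM]%fset.
  by apply/fsetP => t; rewrite memO d0 leqn0 mdeg_eq0 inE.
exists 1%N => //; apply/simplicial_of_typeP => t.
have t0 : t = 0%MM.
  by apply/mnmP => i; have := ltn_ord i; rewrite {2}(hO1 OE).
by rewrite memO t0 mdeg0.
Qed.
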